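(* Let $A$ be an alternative Cartan $*$-algebra with $\mathbb{S}_A\ne\varnothing$, let $\mathcal{C}(A)$ be its Cartan number, and let $\mathcal{G}_A$ be its Cartan graph. Then $\gamma(\mathcal{G}_A)=\mathcal{C}(A)$, where $\gamma$ denotes the domination number of a graph.
   Context: **Cartan $*$-algebras.** Let $n\ge 1$, let $\mathcal{P}(n)$ be the power set of $\{1,\dots,n\}$ and $K\triangle H:=(K\setminus H)\cup(H\setminus K)$. A Cartan algebra is a real (not necessarily associative) algebra $A$ with a fixed real vector basis $\{e_K\}_{K\in\mathcal{P}(n)}$ and a function $\sigma:\mathcal{P}(n)\times\mathcal{P}(n)\to\{-1,1\}$ such that $\sigma(K,\varnothing)=\sigma(\varnothing,K)=1$ and $e_Ke_H=\sigma(K,H)e_{K\triangle H}$ for all $K,H$. Thus $e_\varnothing=1$ is the unity, and $\mathbb{R}$ is identified with $\mathbb{R}1\subset A$. $A$ is alternative if $x(xy)=x^2y$ and $(xy)y=xy^2$ for all $x,y$. A $*$-involution is a real linear map $x\mapsto x^c$ with $(x^c)^c=x$, $(xy)^c=y^cx^c$ and $x^c=x$ for $x\in\mathbb{R}$. A Cartan $*$-algebra is a Cartan algebra endowed with a $*$-involution such that $e_{\{k\}}^c\in\{e_{\{k\}},-e_{\{k\}}\}$ for $k=1,\dots,n$. Set $\mathbb{S}_A:=\{J\in A: J^c=-J,\ J^2=-1\}$. The paper assumes throughout that $A$ is alternative and $\mathbb{S}_A\neq\varnothing$. **Systems of Cartan pairs.** For $L,M\in\mathcal{P}(n)$, $(e_L,e_M)$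 is a Cartan pair if $e_Le_M\in\mathbb{S}_A$ (equivalently $e_{L\triangle M}\in\mathbb{S}_A$). For a set $\mathcal{C}$ of pairs $(e_L,e_M)$, put $\mathcal{C}_1:=\{L:\exists M,\ (e_L,e_M)\in\mathcal{C}\}$ and $\mathcal{C}_2:=\{M:\exists L,\ (e_L,e_M)\in\mathcal{C}\}$. $\mathcal{C}$ is a system of Cartan pairs (SCP) of $A$ if all its elements are Cartan pairs, $\mathcal{C}_1\cup\mathcal{C}_2=\mathcal{P}(n)$ and $\mathcal{C}_1\cap\mathcal{C}_2=\varnothing$. The Cartan number is $\mathcal{C}(A):=\min\{\min\{|\mathcal{C}_1|,|\mathcal{C}_2|\}:\mathcal{C}\text{ is a SCP of }A\}$. **Graphs.** The Cartan graph $\mathcal{G}_A$ is the simple unoriented graph with vertex set $\{e_K\}_{K\in\mathcal{P}(n)}$ and edge set $\{\{e_K,e_H\}:(e_K,e_H)\text{ is a Cartan pair}\}$. A dominating set of a graph is a set $W$ of vertices such that every vertex not in $W$ is adjacent to some vertex in $W$; the domination number is the minimum cardinality of a dominating set. *)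

(* Defs.v *)
From HB Require Import structures.
From mathcomp Require Import all_boot all_order all_algebra.
From mathcomp Require Import reals.

Set Implicit Arguments.
Unset Strict Implicit.
Unset Printing Implicit Defensive.

Import GRing.Theory Num.Theory.
Local Open Scope ring_scope.

Definition symdiff (T : finType) (K H : {set T}) : {set T} :=
  (K :\: H) :|: (H :\: K).

(* The product is a bare bilinear map, since MathComp's algebra structures are
   all associative.  The subset {1, .., n} is modelled by 'I_n. *)
Record cartanAlgebra (R : realType) (n : nat) := CartanAlgebra {
  carrier :> vectType R;
  cmul : {bilinear carrier -> carrier -> carrier};
  cbasis : {set 'I_n} -> carrier;
  csign : {set 'I_n} -> {set 'I_n} -> R;
  cbasisP : basis_of fullv [seq cbasis K | K : {set 'I_n}];
  csignP : forall K H, csign K H = -1 \/ csign K H = 1;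
  csign_set0r : forall K, csign K set0 = 1;
  csign_set0l : forall K, csign set0 K = 1;
  cmul_basis : forall K H,
    cmul (cbasis K) (cbasis H) = csign K H *: cbasis (symdiff K H)
}.

Definition cone (R : realType) (n : nat) (A : cartanAlgebra R n) : A :=
  cbasis A set0.

Definition alternative (R : realType) (n : nat) (A : cartanAlgebra R n) : Prop :=
  forall x y : A,
    cmul A x (cmul A x y) = cmul A (cmul A x x) y /\
    cmul A (cmul A x y) y = cmul A x (cmul A y y).

Record cartanStarAlgebra (R : realType) (n : nat) := CartanStarAlgebra {
  calg :> cartanAlgebra R n;
  cconj : {linear calg -> calg};
  cconjK : forall x, cconj (cconj x) = x;
  cconjM : forall x y, cconj (cmul calg x y) = cmul calg (cconj y) (cconj x);
  cconj_real : forall a : R, cconj (a *: cone calg) = a *: cone calg;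
  cconj_gen : forall k : 'I_n,
    cconj (cbasis calg [set k]) = cbasis calg [set k] \/
    cconj (cbasis calg [set k]) = - cbasis calg [set k]
}.

Section CartanPairs.
Variables (R : realType) (n : nat) (A : cartanStarAlgebra R n).

Definition imag_units : pred A :=
  [pred J : A | (cconj A J == - J) && (cmul A J J == - cone A)].

(* Basis elements are represented by their labels: [cbasis] is injective. *)
Lemma cbasis_inj : injective (cbasis A).
Proof.
have /free_uniq := basis_free (cbasisP A).
by rewrite /image_mem => /injectiveP.
Qed.

Definition cartan_pair (L M : {set 'I_n}) : bool :=
  cmul A (cbasis A L) (cbasis A M) \in imag_units.

Definition scp_fst (C : {set {set 'I_n} * {set 'I_n}}) : {set {set 'I_n}} :=
  [set p.1 | p in C].

Definition scp_snd (C : {set {set 'I_n} * {set 'I_n}}) : {set {set 'I_n}} :=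
  [set p.2 | p in C].

Definition is_scp (C : {set {set 'I_n} * {set 'I_n}}) : bool :=
  [&& [forall p in C, cartan_pair p.1 p.2],
      scp_fst C :|: scp_snd C == [set: {set 'I_n}] &
      scp_fst C :&: scp_snd C == set0].

(* The neutral element 2^n bounds all the values from above, so it does not
   affect the minimum as soon as some SCP exists, which follows from the
   existence of an imaginary unit; see [cartan_number_attained]. *)
Definition cartan_number : nat :=
  \big[minn/#|[set: {set 'I_n}]|]_(C | is_scp C)
     minn #|scp_fst C| #|scp_snd C|.

Lemma cone_neq0 : cone A != 0.
Proof.
have /free_not0 h := basis_free (cbasisP A).
by apply: h; apply: image_f.
Qed.

Lemma cartan_pair_irrefl K : ~~ cartan_pair K K.
Proof.
apply/negP => /andP[/eqP h _]; move: h.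
have -> : cmul A (cbasis A K) (cbasis A K) = csign A K K *: cone A.
  by rewrite cmul_basis /symdiff setDv setU0.
rewrite cconj_real => /eqP; rewrite -subr_eq0 opprK -scalerDl scaler_eq0.
rewrite (negbTE cone_neq0) orbF -mulr2n mulrn_eq0 /=.
by case: (csignP A K K) => ->; rewrite ?oppr_eq0 oner_eq0.
Qed.

End CartanPairs.

Arguments imag_units {R n} A J.

Lemma bigmin_nat_le (T : finType) (P : pred T) (f : T -> nat) m x :
  P x -> (\big[minn/m]_(y | P y) f y <= f x)%N.
Proof.
move=> Px; rewrite -big_filter.
have : x \in [seq y <- index_enum T | P y] by rewrite mem_filter Px mem_index_enum.
elim: [seq y <- _ | _] => // y s IH; rewrite inE big_cons => /orP[/eqP<-|/IH].
  exact: geq_minl.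
exact: leq_trans (geq_minr _ _).
Qed.

Lemma bigmin_nat_attained (T : finType) (P : pred T) (f : T -> nat) m x :
  P x -> (forall y, f y <= m)%N ->
  exists2 y, P y & \big[minn/m]_(z | P z) f z = f y.
Proof.
move=> Px fm.
have : \big[minn/m]_(z | P z) f z = m \/
       exists2 y, P y & \big[minn/m]_(z | P z) f z = f y.
  elim/big_ind: _ => [|a b Ha Hb|y Py]; [by left| |by right; exists y].
  by rewrite /minn; case: ifP.
case=> // e; exists x => //; apply/eqP; rewrite eqn_leq bigmin_nat_le //.
by rewrite e fm.
Qed.

Lemma cartan_number_le (R : realType) (n : nat) (A : cartanStarAlgebra R n) C :
  is_scp A C -> (cartan_number A <= minn #|scp_fst C| #|scp_snd C|)%N.
Proof. exact: bigmin_nat_le. Qed.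

Lemma cartan_number_attained
    (R : realType) (n : nat) (A : cartanStarAlgebra R n) C0 :
  is_scp A C0 ->
  exists2 C, is_scp A C & cartan_number A = minn #|scp_fst C| #|scp_snd C|.
Proof.
move=> hC0; apply: (bigmin_nat_attained hC0) => C.
by rewrite geq_min subset_leq_card // subsetT.
Qed.

Record sgraph := SGraph {
  vertex :> finType;
  edges : {set {set vertex}};
  edgesP : forall e, e \in edges -> #|e| = 2%N
}.

Definition adjacent (G : sgraph) (v w : G) : bool := [set v; w] \in edges G.

Definition dominating (G : sgraph) (W : {set G}) : bool :=
  [forall v, (v \notin W) ==> [exists w in W, adjacent v w]].

Definition domination_number (G : sgraph) : nat :=
  \big[minn/#|G|]_(W : {set G} | dominating W) #|W|.

Lemma domination_number_le (G : sgraph) (W : {set G}) :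
  dominating W -> (domination_number G <= #|W|)%N.
Proof. exact: bigmin_nat_le. Qed.

Lemma domination_number_attained (G : sgraph) :
  exists2 W : {set G}, dominating W & domination_number G = #|W|.
Proof.
have hT : dominating [set: G] by apply/forallP => v; rewrite inE.
by apply: (bigmin_nat_attained hT) => W; apply: max_card.
Qed.

Definition cartan_edges
    (R : realType) (n : nat) (A : cartanStarAlgebra R n) : {set {set {set 'I_n}}} :=
  [set [set p.1; p.2] | p : {set 'I_n} * {set 'I_n} & cartan_pair A p.1 p.2].

Lemma cartan_edgesP (R : realType) (n : nat) (A : cartanStarAlgebra R n) e :
  e \in cartan_edges A -> #|e| = 2%N.
Proof.
case/imsetP=> -[K H]; rewrite inE /= => hKH ->; rewrite cards2.
by case: eqP hKH => // ->; rewrite (negbTE (cartan_pair_irrefl A H)).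
Qed.

Definition cartan_graph
    (R : realType) (n : nat) (A : cartanStarAlgebra R n) : sgraph :=
  SGraph (@cartan_edgesP R n A).

(* Main.v *)
Require Import Defs.
From mathcomp Require Import all_boot all_order all_algebra.
From mathcomp Require Import reals.

(** The Cartan graph is a Cayley graph: up to sign, the product of the basis
    elements labelled L and M is the one labelled by the symmetric difference,
    so (L, M) is a Cartan pair exactly when that difference labels an imaginary
    unit.  In particular the relation is symmetric, and the edges of the graph
    are exactly the Cartan pairs ([adjacent_cartan]).

    A system of Cartan pairs splits the labels into two classes in such a way
    that every label has a Cartan partner in the other class; that is to say,
    both classes are dominating sets.  Conversely, a set W such that both W and
    its complement are dominating gives the system of all Cartan pairs from W
    to its complement.  Hence the Cartan number is the least size of a
    dominating set whose complement is dominating too, and it remains to see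
    that asking this of the complement does not raise the minimum.  This is an
    argument of Ore: in a graph without isolated vertices, the complement of a
    dominating set of least size is dominating ([dominating_setC_of_min]),
    because a vertex of W with no neighbour outside W could be dropped.

    Vertices are not isolated because some basis element is an imaginary unit
    ([basis_imag_unit]).  Every basis element is sent by the involution to plus
    or minus itself, so an imaginary unit J only involves antisymmetric ones,
    and the coefficient of 1 in J J is a sum of squares weighted by the signs
    of the squares of the basis elements that occur.  As this sum is -1, one of
    the basis elements that occur has square -1. *)

Set Implicit Arguments.
Unset Strict Implicit.
Unset Printing Implicit Defensive.

Import GRing.Theory Num.Theory.
Local Open Scope ring_scope.

(** * Symmetric differences *)

Lemma in_symdiff (T : finType) (K H : {set T}) x :
  (x \in symdiff K H) = (x \in K) (+) (x \in H).
Proof. by rewrite !inE; case: (x \in K); case: (x \in H). Qed.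

Lemma symdiffC (T : finType) (K H : {set T}) : symdiff K H = symdiff H K.
Proof. by apply/setP=> x; rewrite !in_symdiff addbC. Qed.

Lemma symdiffKl (T : finType) (K H : {set T}) : symdiff K (symdiff K H) = H.
Proof. by apply/setP=> x; rewrite !in_symdiff addKb. Qed.

Lemma symdiff_eq0 (T : finType) (K H : {set T}) :
  (symdiff K H == set0) = (H == K).
Proof.
apply/eqP/eqP=> [e|->]; apply/setP=> x; last by rewrite in_symdiff addbb inE.
by move/setP: e => /(_ x); rewrite in_symdiff inE; do 2 case: (x \in _).
Qed.

Lemma symdiff_set1l (T : finType) (K : {set T}) x :
  x \in K -> symdiff [set x] (K :\ x) = K.
Proof.
move=> xK; apply/setP=> y; rewrite in_symdiff !inE.
by case: eqP => [->|_] //=.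
Qed.

(** * Coordinates in the basis of a Cartan algebra *)

Definition cbasis_coord (R : realType) (n : nat) (A : cartanAlgebra R n)
    (K : {set 'I_n}) (x : A) : R :=
  coord [tuple of [seq cbasis A H | H : {set 'I_n}]] (enum_rank K) x.

Lemma cbasis_coord_sum (R : realType) n (A : cartanAlgebra R n) K
    (I : Type) (r : seq I) (P : pred I) (F : I -> A) :
  cbasis_coord K (\sum_(i <- r | P i) F i)
  = \sum_(i <- r | P i) cbasis_coord K (F i).
Proof. exact: linear_sum. Qed.

Lemma cbasis_coordZ (R : realType) n (A : cartanAlgebra R n) K a (x : A) :
  cbasis_coord K (a *: x) = a * cbasis_coord K x.
Proof. exact: linearZ. Qed.

Lemma cbasis_coordN (R : realType) n (A : cartanAlgebra R n) K (x : A) :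
  cbasis_coord K (- x) = - cbasis_coord K x.
Proof. exact: linearN. Qed.

Lemma cbasis_coord_basis (R : realType) n (A : cartanAlgebra R n) K H :
  cbasis_coord K (cbasis A H) = (H == K)%:R.
Proof.
rewrite /cbasis_coord; set X := [tuple of _].
have fX : free X := basis_free (cbasisP A).
have <- : X`_(enum_rank H) = cbasis A H by rewrite nth_image enum_rankK.
by rewrite coord_free // (inj_eq enum_rank_inj).
Qed.

Lemma cbasis_expansion (R : realType) n (A : cartanAlgebra R n) (x : A) :
  x = \sum_K cbasis_coord K x *: cbasis A K.
Proof.
rewrite {1}(coord_basis (X := [tuple of _]) (cbasisP A) (memvf x)).
rewrite (reindex enum_rank) /=; last exact/onW_bij/enum_rank_bij.
by apply: eq_bigr => K _; rewrite nth_image enum_rankK.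
Qed.

(** Only the products of a basis element with itself reach 1. *)
Lemma cbasis_coord0_sqr (R : realType) n (A : cartanAlgebra R n) (x : A) :
  cbasis_coord set0 (cmul A x x)
  = \sum_K cbasis_coord K x ^+ 2 * csign A K K.
Proof.
rewrite {1 2}(cbasis_expansion x) linear_sumlz cbasis_coord_sum.
apply: eq_bigr => K _; rewrite linearZl_LR linear_sumr cbasis_coordZ.
rewrite cbasis_coord_sum (bigD1 K) //= big1 => [|H neqHK].
  rewrite linearZr_LR cmul_basis !cbasis_coordZ cbasis_coord_basis symdiff_eq0.
  by rewrite eqxx mulr1 addr0 mulrA -expr2.
rewrite linearZr_LR cmul_basis !cbasis_coordZ cbasis_coord_basis symdiff_eq0.
by rewrite (negPf neqHK) !mulr0.
Qed.

(** * Imaginary units among the basis elements *)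

(** The labels are built up one generator at a time: since e_x e_H is plus or
    minus e_K for H = K minus x, reversing the product by the involution and
    multiplying back only costs signs. *)
Lemma cconj_basis (R : realType) n (A : cartanStarAlgebra R n) K :
  cconj A (cbasis A K) = cbasis A K \/ cconj A (cbasis A K) = - cbasis A K.
Proof.
suff [e [|] ->] : exists2 e : R, e = -1 \/ e = 1
    & cconj A (cbasis A K) = e *: cbasis A K.
- by move=> ->; right; rewrite scaleN1r.
- by move=> ->; left; rewrite scale1r.
have sign_sqr (s : R) : s = -1 \/ s = 1 -> s * s = 1.
  by case=> ->; rewrite ?mulrNN mulr1.
have sign_mul (s t : R) : s = -1 \/ s = 1 -> t = -1 \/ t = 1 ->
    s * t = -1 \/ s * t = 1.
  by case=> -> [] ->; rewrite ?mulrNN ?mulr1 ?mul1r; [right|left|left|right].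
have [m] := ubnP #|K|; elim: m K => // m IH K ltKm.
have [->|[x xK]] := set_0Vmem K.
  exists 1; first by right.
  by have := cconj_real A 1; rewrite !scale1r.
have [|e he eE] := IH (K :\ x).
  by rewrite (cardsD1 x K) xK add1n ltnS in ltKm.
have [d hd dE] : exists2 d : R, d = -1 \/ d = 1
    & cconj A (cbasis A [set x]) = d *: cbasis A [set x].
  case: (cconj_gen A x) => ->; [exists 1|exists (-1)];
    by rewrite ?scaleN1r ?scale1r; auto.
have s1 := csignP A [set x] (K :\ x); have s2 := csignP A (K :\ x) [set x].
have KE : cbasis A K
    = csign A [set x] (K :\ x) *: cmul A (cbasis A [set x]) (cbasis A (K :\ x)).
  by rewrite cmul_basis symdiff_set1l // scalerA sign_sqr // scale1r.
exists (csign A [set x] (K :\ x) * (e * (d * csign A (K :\ x) [set x]))).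
  by apply: (sign_mul _ _ s1); apply: (sign_mul _ _ he); apply: sign_mul hd s2.
rewrite {1}KE linearZ_LR cconjM eE dE linearZl_LR linearZr_LR cmul_basis.
by rewrite symdiffC symdiff_set1l // !scalerA !mulrA.
Qed.

Lemma basis_imag_unit (R : realType) n (A : cartanStarAlgebra R n) (J : A) :
  J \in imag_units A -> exists D, cbasis A D \in imag_units A.
Proof.
case/andP=> /eqP Jc /eqP JJ.
(* On a symmetric basis element, J^c = - J forces the coefficient of J to
   equal its own opposite. *)
have antisym K : cbasis_coord K J != 0 -> cconj A (cbasis A K) = - cbasis A K.
  move=> cK; case: (cconj_basis A K) => // eK.
  have coordc H : cbasis_coord K (cconj A (cbasis A H))
      = (H == K)%:R * cbasis_coord K (cconj A (cbasis A K)).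
    have [->|neqHK] := eqVneq H K; first by rewrite mul1r.
    case: (cconj_basis A H) => ->; rewrite ?cbasis_coordN cbasis_coord_basis;
      by rewrite (negPf neqHK) ?oppr0 mul0r.
  have : cbasis_coord K (cconj A J) = cbasis_coord K J.
    rewrite {1}(cbasis_expansion J) linear_sum cbasis_coord_sum.
    rewrite (bigD1 K) //= big1 => [|H neqHK].
      by rewrite linearZ_LR cbasis_coordZ eK cbasis_coord_basis eqxx mulr1 addr0.
    by rewrite linearZ_LR cbasis_coordZ coordc (negPf neqHK) mul0r mulr0.
  by rewrite Jc cbasis_coordN => /eqP; rewrite eqNr (negPf cK).
have [/existsP[D /andP[cD /eqP sD]]|none] :=
    boolP [exists D, (cbasis_coord D J != 0) && (csign A D D == -1)].
  exists D; apply/andP; split; first exact/eqP/antisym.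
  by rewrite cmul_basis sD scaleN1r /symdiff setDv setU0.
have : 0 <= cbasis_coord set0 (cmul A J J).
  rewrite cbasis_coord0_sqr sumr_ge0 // => K _.
  have [->|cK] := eqVneq (cbasis_coord K J) 0; first by rewrite expr0n mul0r.
  case: (csignP A K K) => sK; last by rewrite sK mulr1 sqr_ge0.
  by case/existsP: none; exists K; rewrite cK sK eqxx.
by rewrite JJ cbasis_coordN cbasis_coord_basis eqxx oppr_ge0 ler10.
Qed.

(** * Cartan pairs as edges *)

Lemma cartan_pairE (R : realType) n (A : cartanStarAlgebra R n) L M :
  cartan_pair A L M = (cbasis A (symdiff L M) \in imag_units A).
Proof.
rewrite /cartan_pair cmul_basis; case: (csignP A L M) => ->; last first.
  by rewrite scale1r.
rewrite scaleN1r !inE !linearN /=; congr andb; first by rewrite eqr_opp.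
by rewrite linearNl opprK.
Qed.

Lemma cartan_pair_sym (R : realType) n (A : cartanStarAlgebra R n) L M :
  cartan_pair A L M = cartan_pair A M L.
Proof. by rewrite !cartan_pairE symdiffC. Qed.

Lemma adjacent_cartan (R : realType) n (A : cartanStarAlgebra R n)
    (L M : cartan_graph A) :
  adjacent L M = cartan_pair A L M.
Proof.
apply/imsetP/idP=> [[[K H]]|LM]; last by exists (L, M); rewrite ?inE.
rewrite inE /= => KH e.
have /set2P KLM : K \in [set L; M] by rewrite e set21.
have /set2P HLM : H \in [set L; M] by rewrite e set22.
have irr := negP (cartan_pair_irrefl A H).
case: KLM HLM KH irr => -> [] -> KH irr //; last by rewrite cartan_pair_sym.
Qed.

(** * Dominating sets of least size *)

Lemma adjacentC (G : sgraph) (v w : G) : adjacent v w = adjacent w v.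
Proof. by rewrite /adjacent setUC. Qed.

Lemma adjacent_neq (G : sgraph) (v w : G) : adjacent v w -> v != w.
Proof. by move/edgesP; rewrite cards2; case: eqP. Qed.

(** If w in W had no neighbour outside W, removing w would leave a smaller
    dominating set: w itself is dominated, since it has a neighbour and all its
    neighbours are in W, and no vertex outside W relied on w. *)
Lemma dominating_setC_of_min (G : sgraph) (W : {set G}) :
  (forall v : G, exists w : G, adjacent v w) ->
  dominating W -> domination_number G = #|W| -> dominating (~: W).
Proof.
move=> noiso domW minW; apply/forallP=> w; rewrite inE negbK.
apply/implyP=> wW; apply: contraT => /existsPn /= isoW.
have nbrW u : adjacent w u -> u \in W.
  by move=> wu; have := isoW u; rewrite inE wu andbT negbK.
suff /domination_number_le : dominating (W :\ w).
  by rewrite minW (cardsD1 w W) wW ltnn.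
apply/forallP=> v; apply/implyP; rewrite !inE negb_and negbK.
have [->|neqvw] /= := eqVneq v w.
  have [u wu] := noiso w => _; apply/existsP; exists u.
  by rewrite !inE wu nbrW // eq_sym adjacent_neq.
move=> vW; have /existsP[u /andP[uW vu]] := implyP (forallP domW v) vW.
apply/existsP; exists u; rewrite !inE uW vu !andbT.
by apply: contraNneq vW => eqw; rewrite nbrW // adjacentC -eqw.
Qed.

(** * Systems of Cartan pairs as pairs of dominating sets *)

Lemma scp_dominating (R : realType) n (A : cartanStarAlgebra R n) C :
  is_scp A C ->
  @dominating (cartan_graph A) (scp_fst C)
  && @dominating (cartan_graph A) (scp_snd C).
Proof.
case/and3P=> /forallP pairC /eqP covC _.
apply/andP; split; apply/forallP=> v; apply/implyP=> vC.
- have : v \in scp_fst C :|: scp_snd C by rewrite covC.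
  rewrite inE (negPf vC) => /imsetP[p pC ->].
  apply/existsP; exists p.1; rewrite adjacent_cartan cartan_pair_sym.
  by rewrite (implyP (pairC p)) // andbT; apply: imset_f.
- have : v \in scp_fst C :|: scp_snd C by rewrite covC.
  rewrite inE (negPf vC) orbF => /imsetP[p pC ->].
  apply/existsP; exists p.2; rewrite adjacent_cartan.
  by rewrite (implyP (pairC p)) // andbT; apply: imset_f.
Qed.

Lemma dominating_scp (R : realType) n (A : cartanStarAlgebra R n)
    (W : {set cartan_graph A}) :
  dominating W -> dominating (~: W) ->
  exists2 C, is_scp A C & scp_fst C = W.
Proof.
move=> domW domWC.
pose C : {set {set 'I_n} * {set 'I_n}} :=
  [set p | [&& p.1 \in W, p.2 \notin W & cartan_pair A p.1 p.2]].
have fstC : scp_fst C = W.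
  apply/setP=> L; apply/imsetP/idP=> [[p]|LW].
    by rewrite inE => /and3P[pW _ _ ->].
  have /existsP[M] : [exists w in ~: W, adjacent (L : cartan_graph A) w].
    by apply: (implyP (forallP domWC L)); rewrite inE LW.
  rewrite inE adjacent_cartan => /andP[MW LM].
  by exists (L, M); rewrite // inE /= LW MW.
have sndC : scp_snd C = ~: W.
  apply/setP=> M; rewrite inE.
  apply/imsetP/idP=> [[p]|MW].
    by rewrite inE => /and3P[_ pW _ ->].
  have /existsP[L] := implyP (forallP domW M) MW.
  rewrite adjacent_cartan cartan_pair_sym => /andP[LW LM].
  by exists (L, M); rewrite // inE /= LW MW.
exists C => //; rewrite /is_scp fstC sndC setUCr setICr !eqxx !andbT.
by apply/forallP=> p; apply/implyP; rewrite inE => /and3P[].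
Qed.

Theorem proposition6p20 (R : realType) (n : nat) (A : cartanStarAlgebra R n)
    (n_ge1 : (1 <= n)%N)
    (A_alt : alternative A)
    (SA_nonempty : exists J : A, J \in imag_units A) :
  domination_number (cartan_graph A) = cartan_number A.
Proof.
have [J /basis_imag_unit[D imD]] := SA_nonempty.
have noiso (v : cartan_graph A) : exists w : cartan_graph A, adjacent v w.
  by exists (symdiff v D); rewrite adjacent_cartan cartan_pairE symdiffKl.
have [W domW minW] := domination_number_attained (cartan_graph A).
have [C scpC fstC] :=
  dominating_scp domW (dominating_setC_of_min noiso domW minW).
apply/eqP; rewrite eqn_leq; apply/andP; split.
  have [C' /scp_dominating/andP[dom1 dom2] ->] := cartan_number_attained scpC.
  by rewrite leq_min !domination_number_le.
by rewrite minW -fstC (leq_trans (cartan_number_le scpC)) // geq_minl.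
Qed.
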